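(* Let $\mathcal{A},\mathcal{B}$ be subsets in $\mathbb{F}_q$. If $$|\mathcal{A}|\ge q^{\frac12+\epsilon}\quad\text{and}\quad |\mathcal{B}|\ge q^{1-\frac{2\epsilon}{3}}$$ for some $\epsilon\ge 0$, then the number of congruence classes of triangles determined by $\mathcal{A}\times\mathcal{B}\subseteq\mathbb{F}_q^2$ is at least $c\,q^3$ for some positive constant $c$.
   Context: $\mathbb{F}_q$ is the finite field of order $q$, where $q=p^r$ for some prime $p$ and positive integer $r$. $O(2,\mathbb{F}_q)$ denotes the orthogonal group in $\mathbb{F}_q^2$, i.e. the group of linear maps of $\mathbb{F}_q^2$ preserving the standard form $x_1^2+x_2^2$. A triangle ($2$-simplex) in $\mathbb{F}_q^2$ is given by its vertices $(\mathbf{x}_1,\mathbf{x}_2,\mathbf{x}_3)$ in $\mathbb{F}_q^2$. Two triangles with vertices $(\mathbf{x}_1,\mathbf{x}_2,\mathbf{x}_3)$ and $(\mathbf{y}_1,\mathbf{y}_2,\mathbf{y}_3)$ are in the same congruence class if there exist $\theta\in O(2,\mathbb{F}_q)$ and $\mathbf{z}\in\mathbb{F}_q^2$ with $\mathbf{z}+\theta(\mathbf{x}_i)=\mathbf{y}_i$ for $i=1,2,3$. The number of congruence classes of triangles determined by a set $\mathcal{E}\subseteq\mathbb{F}_q^2$ is the number of congruence classes containing a triangle all of whose vertices lie in $\mathcal{E}$.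
   Formalization: The order q is assumed odd; for q a power of 2 the claim fails, since then the form is (x_1+x_2)^2, O(2,F_q) has q(q-1) elements, and all of F_q^2 determines only O(q^2) congruence classes of triangles. *)

(* Defs.v *)
From HB Require Import structures.
From mathcomp Require Import all_boot all_order all_algebra.

Set Implicit Arguments.
Unset Strict Implicit.
Unset Printing Implicit Defensive.

Import GRing.Theory.
Local Open Scope ring_scope.

Section Triangles.
Variable F : finFieldType.

Definition point := 'cV[F]_2.

Definition std_form (x : point) : F := \sum_(i < 2) x i 0 ^+ 2.

Definition orthogonal_group : {set 'M[F]_2} :=
  [set theta in unitmx | [forall x, std_form (theta *m x) == std_form x]].

(* Degenerate (collinear or repeated) vertices are allowed. *)
Definition triangle := {ffun 'I_3 -> point}.

Definition congruent : rel triangle := fun x y =>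
  [exists theta in orthogonal_group, exists z : point,
    forall i, z + theta *m x i == y i].

Definition congruence_classes : {set {set triangle}} :=
  equivalence_partition congruent [set: triangle].

Definition determined_classes (E : {set point}) : {set {set triangle}} :=
  [set C in congruence_classes | [exists x in C, forall i, x i \in E]].

Definition cartesian (A B : {set F}) : {set point} :=
  [set x : point | (x 0 0 \in A) && (x 1 0 \in B)].

Lemma congruent_equivalence :
  {in [set: triangle] & &, equivalence_rel congruent}.
Proof.
have congP (x y : triangle) : reflect (exists theta (z : point), theta \in orthogonal_group /\
    forall i : 'I_3, z + theta *m x i = y i) (congruent x y).
  apply: (iffP exists_inP) => [[t Ot /existsP[z /forallP e]]|[t [z [Ot e]]]].
    by exists t, z; split=> // i; apply/eqP.
  by exists t => //; apply/existsP; exists z; apply/forallP => i; apply/eqP.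
have refl x : congruent x x.
  apply/congP; exists 1%:M, 0; split=> [|i]; last by rewrite mul1mx add0r.
  by rewrite inE unitmx1; apply/forallP => y; rewrite mul1mx.
have sym x y : congruent x y -> congruent y x.
  case/congP=> t [z [/[!inE]/andP[ut /forallP pt] e]]; apply/congP.
  exists (invmx t), (- (invmx t *m z)); split=> [|i].
    rewrite inE unitmx_inv ut; apply/forallP => v.
    by rewrite -(eqP (pt _)) mulKVmx.
  by rewrite -e mulmxDr mulKmx // addKr.
have trans x y w : congruent x y -> congruent y w -> congruent x w.
  case/congP=> t [z [/[!inE]/andP[ut /forallP pt] e]].
  case/congP=> t' [z' [/[!inE]/andP[ut' /forallP pt'] e']]; apply/congP.
  exists (t' *m t), (z' + t' *m z); split=> [|i].
    rewrite inE unitmx_mul ut ut'; apply/forallP => v.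
    by rewrite -mulmxA (eqP (pt' _)) (eqP (pt _)).
  by rewrite -e' -e mulmxDr mulmxA addrA.
move=> x y w _ _ _; split=> // xy.
by apply/idP/idP; apply: trans => //; apply: sym.
Qed.

End Triangles.

(* Main.v *)
(** Write [E = A * B] with [a = #|A|], [b = #|B|], [m = min a b].  By Cauchy-Schwarz over the
congruence classes, [|E|^6] is at most the number of classes times the number of congruent
pairs of triangles in [E], and the latter is at most the sum of [r(theta, z)^3] over the rigid
motions, where [r(theta, z)] counts the [x] in [E] with [z + theta x] in [E].

For non-diagonal [theta], two coordinates determine [x], so [r <= m^2]; hence the
cubes are controlled by [m^2] times the variance of [r] around its mean [|E|^2 / q^2].  The
second moment of [r] counts the quadruples of [E] with two equal distances.  Completing one
variable to the whole field, where the equation is linear in it, shows that there are at most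
[|E|^4 / q + 2 q m |E|^2] of them, so that the variance is [O(q m |E|^2)].  The diagonal
[theta] contribute [O(|E|^4)].  Both errors are [O(|E|^6 / q^3)] as soon as
[a^2 b^3 >= q^4] and [(a b)^2 >= q^3], which the hypotheses give. *)

Require Import Defs.
From HB Require Import structures.
From mathcomp Require Import all_boot all_order all_algebra.
From mathcomp Require Import reals exp.
From mathcomp Require Import fingroup cyclic ring lra.

Set Implicit Arguments.
Unset Strict Implicit.
Unset Printing Implicit Defensive.

Import Order.TTheory GRing.Theory Num.Theory.
Local Open Scope ring_scope.

(** * Finite sums and fibers *)

Section FiniteSums.
Variable R : realFieldType.

Lemma sum_sqrB (I : finType) (P : pred I) (f : I -> R) (mu : R) :
  \sum_(i | P i) (f i - mu) ^+ 2 =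
  \sum_(i | P i) f i ^+ 2 - 2 * mu * (\sum_(i | P i) f i) + #|P|%:R * mu ^+ 2.
Proof.
rewrite (eq_bigr (fun i => f i ^+ 2 + (- (2 * mu) * f i + mu ^+ 2))).
  by rewrite !big_split /= -mulr_sumr sumr_const -[_ *+ #|_|]mulr_natl mulNr addrA.
by move=> i _; ring.
Qed.

(** Cauchy-Schwarz, read off from the nonnegative variance of [f] around its mean over [P]. *)
Lemma sqr_sum_le (I : finType) (P : pred I) (f : I -> R) :
  (\sum_(i | P i) f i) ^+ 2 <= #|P|%:R * \sum_(i | P i) f i ^+ 2.
Proof.
have [P0|P_gt0] := posnP #|P|.
  by rewrite !big1 ?mulr0 ?expr0n // => i Pi; have := card0_eq P0 i; rewrite [_ \in _]Pi.
have n_gt0 : 0 < #|P|%:R :> R by rewrite ltr0n.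
set s := \sum_(i | P i) f i.
have : 0 <= \sum_(i | P i) (f i - s / #|P|%:R) ^+ 2.
  by apply: sumr_ge0 => i _; exact: sqr_ge0.
rewrite sum_sqrB -/s -(pmulr_rge0 _ n_gt0); set t := \sum_(i | P i) _.
suff -> : #|P|%:R * (t - 2 * (s / #|P|%:R) * s + #|P|%:R * (s / #|P|%:R) ^+ 2)
  = #|P|%:R * t - s ^+ 2 by rewrite subr_ge0.
by field; rewrite gt_eqF.
Qed.

End FiniteSums.

Section Fibers.
Variables (I T : finType) (P : {set I}) (f : I -> T).

Lemma sum_card_fiber : (\sum_t #|[set i in P | f i == t]| = #|P|)%N.
Proof.
rewrite -[RHS]sum1_card (partition_big f predT) //=.
by apply: eq_bigr => t _; rewrite -sum1_card; apply: eq_bigl => i; rewrite inE.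
Qed.

(** Both sides count the pairs of elements of [P] with equal images. *)
Lemma sum_card_fiber_sqr :
  (\sum_t #|[set i in P | f i == t]| ^ 2 =
   \sum_(i in P) #|[set j in P | f j == f i]|)%N.
Proof.
rewrite [RHS](partition_big f predT) //=; apply: eq_bigr => t _.
rewrite (eq_bigr (fun=> #|[set j in P | f j == t]|)); last by move=> i /andP[_ /eqP->].
by rewrite sum_nat_const -mulnn; congr (_ * _)%N; apply: eq_card => i; rewrite !inE.
Qed.

End Fibers.

Lemma card_set_sum (I : finType) (P : {set I}) (r : pred I) :
  #|[set i in P | r i]| = (\sum_(i in P) r i)%N.
Proof.
rewrite -sum1_card big_mkcond [RHS]big_mkcond; apply: eq_bigr => i _.
by rewrite inE; case: (i \in P); case: (r i).
Qed.

Lemma card_sig_sum (I J : finType) (P : {set I}) (Q : {set J}) (r : I -> J -> bool) :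
  (\sum_(i in P) #|[set j in Q | r i j]| = \sum_(j in Q) #|[set i in P | r i j]|)%N.
Proof.
under eq_bigr do rewrite -sum1_card; under [RHS]eq_bigr do rewrite -sum1_card.
rewrite (exchange_big_dep (mem Q)) /=; last by move=> i j _ /[!inE]/andP[].
by apply: eq_bigr => j Qj; apply: eq_bigl => i; rewrite !inE Qj.
Qed.

(** By Lagrange in the additive group, [#|F|] vanishes in [F], whereas an odd integer becomes [1]
    there once [2] vanishes. *)
Lemma odd_card_two_neq0 (F : finFieldType) : odd #|F| -> 2 != 0 :> F.
Proof.
move=> odd_q; apply/eqP => two0; have := oner_neq0 F; case/eqP.
have: #|F|%:R == 0 :> F by rewrite -FinRing.zmodXgE -order_dvdn -cardsT order_dvdG ?inE.
by rewrite -(odd_double_half #|F|) odd_q natrD -mul2n natrM two0 mul0r addr0 => /eqP.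
Qed.

(** * Distances in a product set *)

Section Plane.
Variable F : finFieldType.

Lemma card_sqr_eq (k : F) : (#|[set t | t ^+ 2 == k]| <= 2)%N.
Proof.
have [->|[t0 /[!inE]/eqP tk]] := set_0Vmem [set t | t ^+ 2 == k]; first by rewrite cards0.
apply: leq_trans (_ : #|[set t0; - t0]| <= _)%N; last by rewrite cards2; case: eqP.
by apply/subset_leq_card/subsetP => t; rewrite !inE -tk eqf_sqr.
Qed.


Lemma card_setX_sum (I J : finType) (P : {set I}) (Q : {set J}) (r : I -> J -> bool) :
  #|[set p in setX P Q | r p.1 p.2]| = (\sum_(i in P) #|[set j in Q | r i j]|)%N.
Proof.
under eq_bigr do rewrite -sum1_card; rewrite -sum1_card pair_big_dep /=.
by apply: eq_bigl => -[i j]; rewrite !inE /= andbA.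
Qed.

(* The sum over [u] is completed from [B] to the whole field after Cauchy-Schwarz. *)
Lemma fiber_energy_completion (R : realFieldType) (T : finType) (B : {set F}) (W : {set T})
    (h : F -> T -> F) (X : R) :
  (\sum_(w in W) \sum_(w' in W) #|[set u | h u w' == h u w]|)%:R <= #|W|%:R ^+ 2 + X ->
  (\sum_t #|[set p in setX B W | h p.1 p.2 == t]| ^ 2)%:R <=
    (#|B|%:R * #|W|%:R) ^+ 2 / #|F|%:R + #|B|%:R * X.
Proof.
move=> le_X; set q : R := #|F|%:R; set b : R := #|B|%:R; set w : R := #|W|%:R.
have q_gt0 : 0 < q by rewrite ltr0n; apply/card_gt0P; exists 0.
have q_neq0 : q != 0 by rewrite gt_eqF.
pose D t : R := #|[set p in setX B W | h p.1 p.2 == t]|%:R.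
pose Du u t : R := #|[set v in W | h u v == t]|%:R.
have DE t : D t = \sum_(u in B) Du u t.
  by rewrite /D (card_setX_sum B W (fun u v => h u v == t)) natr_sum.
have sumD : \sum_t D t = b * w.
  by rewrite -natr_sum (sum_card_fiber _ (fun p => h p.1 p.2)) cardsX natrM.
have sumDu u : \sum_t Du u t = w by rewrite -natr_sum sum_card_fiber.
have varD : \sum_t (D t - b * w / q) ^+ 2 = \sum_t D t ^+ 2 - (b * w) ^+ 2 / q.
  by rewrite sum_sqrB sumD -/q; field.
have varDu u : \sum_t (Du u t - w / q) ^+ 2 = \sum_t Du u t ^+ 2 - w ^+ 2 / q.
  by rewrite sum_sqrB sumDu -/q; field.
(* Cauchy-Schwarz over [B]; as squares are nonnegative, the sum may then run over every [u] of the
   field. *)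
have leD t : (D t - b * w / q) ^+ 2 <= b * \sum_u (Du u t - w / q) ^+ 2.
  have -> : D t - b * w / q = \sum_(u in B) (Du u t - w / q).
    by rewrite sumrB -DE sumr_const -[_ *+ _]mulr_natl mulrA.
  apply: le_trans (sqr_sum_le _ _) _; rewrite ler_wpM2l ?ler0n //.
  by rewrite [leRHS](bigID (mem B)) /= lerDl sumr_ge0 // => u _; exact: sqr_ge0.
(* The left side counts the triples [(u, v, v')] with [h u v' = h u v], and so does the left side of
   [le_X], in another order of summation. *)
have sumDu2 : \sum_u \sum_t Du u t ^+ 2 <= w ^+ 2 + X.
  apply: le_trans le_X; rewrite le_eqVlt; apply/orP; left; apply/eqP.
  transitivity ((\sum_u \sum_t #|[set v in W | h u v == t]| ^ 2)%:R : R)%N.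
    rewrite natr_sum; apply: eq_bigr => u _; rewrite natr_sum.
    by apply: eq_bigr => t _; rewrite natrX.
  congr (_%:R); rewrite (eq_bigr (fun u => \sum_(i in W)
      #|[set j in W | h u j == h u i]|)%N); last by move=> u _; exact: sum_card_fiber_sqr.
  rewrite exchange_big; apply: eq_bigr => i _ /=.
  have := card_sig_sum [set: F] W (fun u j => h u j == h u i).
  rewrite (eq_bigl xpredT) => [->|u]; last by rewrite inE.
  by apply: eq_bigr => j _; apply: eq_card => u; rewrite !inE.
rewrite natr_sum; under eq_bigr do rewrite natrX.
rewrite -lerBlDl -varD; apply: le_trans (ler_sum _ (fun t _ => leD t)) _.
rewrite -mulr_sumr exchange_big ler_wpM2l ?ler0n //=.
under eq_bigr do rewrite varDu.
rewrite sumrB sumr_const -[_ *+ _]mulr_natl -/q.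
(* Over the [q] values of [u], the subtracted [w ^+ 2 / q] add up to [w ^+ 2], which leaves only
   [X]. *)
by rewrite mulrCA divff // mulr1 lerBlDl.
Qed.

Definition dist2 (x y : F * F) : F := (x.1 - y.1) ^+ 2 + (x.2 - y.2) ^+ 2.

(** By [sum_card_fiber_sqr], this is the number of quadruples of points of [E] in which two given
    distances agree. *)
Definition dist_energy (E : {set F * F}) : nat :=
  (\sum_t #|[set p in setX E E | dist2 p.1 p.2 == t]| ^ 2)%N.

Hypothesis F_odd : odd #|F|.

Lemma card_affine_zeros (a b : F) :
  (#|[set u : F | (a * u == b)%R]| <= 1 + #|F| * ((a == 0%R) && (b == 0%R)))%N.
Proof.
have [->|a0] := eqVneq a 0.
  have [->|b0] := eqVneq b 0; first by rewrite muln1 (leq_trans (max_card _)) ?leq_addl.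
  by rewrite (eq_card0 (_ : _ =i pred0)) // => u; rewrite !inE mul0r eq_sym (negPf b0).
rewrite muln0 addn0; apply: leq_trans (_ : #|[set b / a]| <= _)%N;
    last by rewrite cards1.
apply/subset_leq_card/subsetP => u; rewrite !inE => /eqP <-.
by rewrite mulrAC divff ?mul1r.
Qed.

(** The completed variable [u] is the second coordinate of the first point; [W] collects the three
    others. In [h u w' = h u w] the squares of [u] cancel, so the equation is affine in [u] and has
    one solution at most, unless it degenerates. *)
Lemma dist_energy_product (R : realFieldType) (A B : {set F}) :
  (dist_energy (setX A B))%:R <= (#|A| * #|B|)%:R ^+ 4 / #|F|%:R
     + 2 * #|F|%:R * #|A|%:R * (#|A| * #|B|)%:R ^+ 2 :> R.
Proof.
pose W := setX (setX A A) B.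
pose h u (w : F * F * F) := (w.1.1 - w.1.2) ^+ 2 + (u - w.2) ^+ 2.
pose f (p : (F * F) * (F * F)) : F * ((F * F) * F) := (p.1.2, ((p.1.1, p.2.1), p.2.2)).
pose g (p : F * ((F * F) * F)) : (F * F) * (F * F) := ((p.2.1.1, p.1), (p.2.1.2, p.2.2)).
have fK : cancel f g by case=> -[? ?] [].
have gK : cancel g f by case=> ? [] [].
have -> : dist_energy (setX A B) =
    (\sum_t #|[set p in setX B W | h p.1 p.2 == t]| ^ 2)%N.
  apply: eq_bigr => t _; congr (_ ^ 2)%N; rewrite -(on_card_preimset (f := f)).
    apply: eq_card => -[[x1 x2] [y1 y2]]; rewrite !inE /=; congr (_ && _).
    by case: (x1 \in A); case: (x2 \in B); case: (y1 \in A).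
  by exists g => ? _.
apply: le_trans (fiber_energy_completion (X := (#|W| * (2 * #|A| * #|F|))%:R) _ _) _.
  rewrite -natrX -natrD ler_nat.
  have -> : (#|W| ^ 2 + #|W| * (2 * #|A| * #|F|) =
      \sum_(w in W) (#|W| + 2 * #|A| * #|F|))%N by rewrite sum_nat_const -mulnn mulnDr.
  apply: leq_sum => -[[x y] v] /[!inE] /= /andP[/andP[xA yA] vB].
  (* These are the [w] for which the affine equation holds for every [u]. *)
  pose bad (w : F * F * F) := (w.2 == v) && ((w.1.1 - w.1.2) ^+ 2 == (x - y) ^+ 2).
  apply: leq_trans (_ : \sum_(w in W) (1 + #|F| * bad w) <= _)%N.
    apply: leq_sum => -[[x' y'] v'] _; rewrite /bad /h /=.
    have := card_affine_zeros (2 * (v - v'))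
      ((x - y) ^+ 2 + v ^+ 2 - (x' - y') ^+ 2 - v' ^+ 2).
    have -> : [set u | 2 * (v - v') * u == (x - y) ^+ 2 + v ^+ 2 - (x' - y') ^+ 2 - v' ^+ 2] =
       [set u | (x' - y') ^+ 2 + (u - v') ^+ 2 == (x - y) ^+ 2 + (u - v) ^+ 2].
      apply/setP => u; rewrite !inE -subr_eq0 -[RHS]subr_eq0.
      by congr (_ == _); ring.
    move/leq_trans; apply; rewrite leq_add2l leq_mul2l.
    rewrite mulf_eq0 (negPf (odd_card_two_neq0 F_odd)) subr_eq0 [v' == v]eq_sym /=.
    case: (eqVneq v v') => [->|_] /=; last by rewrite leqnn orbT.
    by rewrite addrAC addrK subr_eq0 [_ == (x - y) ^+ 2]eq_sym leqnn orbT.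
  rewrite big_split sum1_card leq_add2l -big_distrr /= [leqRHS]mulnC leq_mul2l.
  apply/orP; right.
  rewrite -card_set_sum.
  pose S := [set d | d ^+ 2 == (x - y) ^+ 2].
  apply: leq_trans (_ : #|setX S A| <= _)%N; last by rewrite cardsX leq_mul2r card_sqr_eq orbT.
  (* A bad [w] is determined by its first entry, in [A], and a difference with prescribed square,
     hence the bound [2 * #|A|]. *)
  pose k (w : F * F * F) := (w.1.1 - w.1.2, w.1.1).
  rewrite -(card_in_imset (f := k)).
    apply/subset_leq_card/subsetP => _ /imsetP[w + ->].
    by rewrite !inE => /andP[/andP[/andP[-> _] _] /andP[_ ->]].
  move=> [[x1 y1] v1] [[x2 y2] v2]; rewrite !inE /bad /k /= => /andP[_ /andP[/eqP-> _]].
  case/andP=> _ /andP[/eqP-> _]. case=> exy ex.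
  by move: exy; rewrite ex => /addrI/oppr_inj ->.
rewrite !cardsX !natrM.
set a : R := #|A|%:R; set b : R := #|B|%:R; set q : R := #|F|%:R.
rewrite le_eqVlt; apply/orP; left; apply/eqP; congr (_ / _ + _); ring.
Qed.

(** Lets the energy bound be used with the smaller factor in the first place. *)
Lemma dist_energy_swap (A B : {set F}) :
  dist_energy (setX A B) = dist_energy (setX B A).
Proof.
pose f (p : (F * F) * (F * F)) := ((p.1.2, p.1.1), (p.2.2, p.2.1)).
have fK : cancel f f by move=> [[? ?] []].
apply: eq_bigr => t _; congr (_ ^ 2)%N; rewrite -(on_card_preimset (f := f)).
  apply: eq_card => -[[x1 x2] [y1 y2]]; rewrite !inE /dist2 /= [(x2 - y2) ^+ 2 + _]addrC.
  by rewrite [(x2 \in _) && _]andbC [(y2 \in _) && _]andbC.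
by exists f => ? _.
Qed.

(** * Rotations, reflections and overlaps *)

Definition circle : {set F * F} := [set g | g.1 ^+ 2 + g.2 ^+ 2 == 1].

Lemma card_circle_le : (#|circle| <= 2 * #|F|)%N.
Proof.
have -> : circle = [set g in setX setT setT | g.1 ^+ 2 + g.2 ^+ 2 == 1].
  by apply/setP => g; rewrite !inE.
rewrite (card_setX_sum setT setT (fun c s => c ^+ 2 + s ^+ 2 == 1)).
apply: leq_trans (_ : \sum_(c in [set: F]) 2 <= _)%N; last first.
  by rewrite sum_nat_const cardsT mulnC.
apply: leq_sum => c _; apply: leq_trans (card_sqr_eq (1 - c ^+ 2)).
by apply/subset_leq_card/subsetP => s; rewrite !inE => /eqP <-; rewrite addrAC subrr add0r.
Qed.

(* Stereographic projection from [(-1, 0)]. *)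
Lemma card_circle_ge : (#|F| <= #|circle| + 2)%N.
Proof.
have two0 := odd_card_two_neq0 F_odd.
(* The poles of the parametrization; there are at most two, whence the [2] in the statement. *)
pose S := [set t : F | t ^+ 2 == -1].
rewrite -(cardC (mem S)) addnC leq_add ?card_sqr_eq //.
pose f (t : F) := ((1 - t ^+ 2) / (1 + t ^+ 2), 2 * t / (1 + t ^+ 2)).
have nz t : t \in [predC S] -> 1 + t ^+ 2 != 0 by rewrite !inE addrC addr_eq0.
rewrite -(card_in_imset (f := f)).
  apply/subset_leq_card/subsetP => _ /imsetP[t /nz t0 ->]; rewrite inE /=.
  by apply/eqP; field.
have fE t : t \in [predC S] -> t = (f t).2 / (1 + (f t).1).
  move=> /nz t0; rewrite /f /=.
  have -> : 1 + (1 - t ^+ 2) / (1 + t ^+ 2) = 2 / (1 + t ^+ 2) by field.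
  by field; rewrite t0 two0.
by move=> t t' /fE {2}-> /fE {2}-> ->.
Qed.

(* [g = (c, s)] acts by the matrix [((c, - e s), (s, e c))]: a rotation for [e = 1], a
   reflection for [e = -1]. *)
Definition rot_refl (e : F) (g x : F * F) : F * F :=
  (g.1 * x.1 - e * g.2 * x.2, g.2 * x.1 + e * g.1 * x.2).

(** Counting pairs [(x, y)] with [y = z + theta x] makes this a fiber size over [z], so that the
    fiber lemmas give its first two moments. *)
Definition overlap (e : F) (E : {set F * F}) (g z : F * F) : nat :=
  #|[set p in setX E E | p.2 - rot_refl e g p.1 == z]|.

Lemma sum_overlap e E g : (\sum_z overlap e E g z = #|E| ^ 2)%N.
Proof. by rewrite sum_card_fiber cardsX mulnn. Qed.

Lemma overlap_le e E g z : (overlap e E g z <= #|E|)%N.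
Proof.
rewrite /overlap -(card_in_imset (f := fst)).
  by apply/subset_leq_card/subsetP => _ /imsetP[p /[!inE]/andP[/andP[? _] _] ->].
move=> [x y] [x' y'] /[!inE] /= /andP[_ /eqP ez] /andP[_ /eqP ez'] exx.
by congr pair => //; apply: (subIr (rot_refl e g x)); rewrite ez exx ez'.
Qed.

(** The off-diagonal entries of the matrix are invertible, so one coordinate of [x] and the same
    coordinate of its image determine the other coordinate of [x], then the whole image. The
    coordinate kept is the one in the smaller factor. *)
Lemma overlap_product_le e A B g z : e != 0 -> g.2 != 0 ->
  (overlap e (setX A B) g z <= minn #|A| #|B| ^ 2)%N.
Proof.
case: g => c s e0 /= s0; case: z => z1 z2.
have key (k : (F * F) * (F * F) -> F * F) (C : {set F}) :
  (forall p, p \in setX (setX A B) (setX A B) -> k p \in setX C C) ->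
  (forall p p', k p = k p' -> p.2 - rot_refl e (c, s) p.1 = (z1, z2) ->
    p'.2 - rot_refl e (c, s) p'.1 = (z1, z2) -> p = p') ->
  (overlap e (setX A B) (c, s) (z1, z2) <= #|C| ^ 2)%N.
  move=> kC k_inj; rewrite -mulnn -cardsX /overlap -(card_in_imset (f := k)).
    by apply/subset_leq_card/subsetP => _ /imsetP[p + ->]; rewrite inE => /andP[? _]; apply: kC.
  by move=> p p' /[!inE]/andP[_ /eqP e1] /andP[_ /eqP e2] e3; apply: k_inj.
have [_|_] := leqP #|A| #|B|.
  apply: (key (fun p => (p.1.1, p.2.1))) => [[[x1 x2] [y1 y2]]|].
    by rewrite !inE /= => /andP[/andP[-> _] /andP[-> _]].
  move=> [[x1 x2] [y1 y2]] [[x1' x2'] [y1' y2']] /= [<- <-] [/= e1 e2] [/= e1' e2'].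
  have ex : x2 = x2'.
    by apply: (mulfI (mulf_neq0 e0 s0)); move: e1'; rewrite -e1 => /addrI/oppr_inj/addrI/oppr_inj.
  by rewrite -ex; congr (_, (_, _)); move: e2'; rewrite -e2 -ex => /addIr.
apply: (key (fun p => (p.1.2, p.2.2))) => [[[x1 x2] [y1 y2]]|].
  by rewrite !inE /= => /andP[/andP[_ ->] /andP[_ ->]].
move=> [[x1 x2] [y1 y2]] [[x1' x2'] [y1' y2']] /= [<- <-] [/= e1 e2] [/= e1' e2'].
have ex : x1 = x1'.
  by apply: (mulfI s0); move: e2'; rewrite -e2 => /addrI/oppr_inj/addIr.
by rewrite -ex; congr ((_, _), (_, _)); move: e1'; rewrite -e1 -ex => /addIr.
Qed.

Lemma rot_reflB e g x y : rot_refl e g (x - y) = rot_refl e g x - rot_refl e g y.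
Proof. by congr pair => /=; ring. Qed.

(* Distinct [g] would differ by a nonzero isotropic vector orthogonal to a point of the circle. *)
Lemma rot_refl_inj e x : e ^+ 2 = 1 -> x != 0 ->
  {in circle &, injective (fun g => rot_refl e g x)}.
Proof.
case: x => x1 x2 e2 x0 [c s] [c' s']; rewrite !inE /= => /eqP g1 /eqP g1' [/= h1 h2].
pose d := c - c'; pose f := s - s'.
have k1 : d * x1 = e * f * x2.
  apply: subr0_eq; transitivity (c * x1 - e * s * x2 - (c' * x1 - e * s' * x2)).
    by rewrite /d /f; ring.
  by rewrite h1 subrr.
have k2 : f * x1 = - (e * d * x2).
  apply: subr0_eq; transitivity (s * x1 + e * c * x2 - (s' * x1 + e * c' * x2)).
    by rewrite /d /f; ring.
  by rewrite h2 subrr.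
have df0 : d ^+ 2 + f ^+ 2 = 0.
  apply/eqP; apply: contraNT x0 => nz.
  have x10 : (d ^+ 2 + f ^+ 2) * x1 = 0.
    rewrite (_ : _ * x1 = d * (d * x1) + f * (f * x1)); last by ring.
    by rewrite k1 k2; ring.
  have x20 : (d ^+ 2 + f ^+ 2) * x2 = 0.
    rewrite (_ : _ * x2 = e ^+ 2 * (d ^+ 2 + f ^+ 2) * x2); last by rewrite e2 mul1r.
    rewrite (_ : _ * x2 = - (e * d * (- (e * d * x2))) + e * f * (e * f * x2)); last by ring.
    by rewrite -k1 -k2; ring.
  move/eqP: x10; move/eqP: x20; rewrite !mulf_eq0 (negPf nz) /= => /eqP-> /eqP->.
  exact: eqxx.
have orth : c' * d + s' * f = 0.
  apply: (mulfI (odd_card_two_neq0 F_odd)); rewrite mulr0.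
  transitivity ((c ^+ 2 + s ^+ 2) - (c' ^+ 2 + s' ^+ 2) - (d ^+ 2 + f ^+ 2)).
    by rewrite /d /f; ring.
  by rewrite g1 g1' df0; ring.
have sqf0 : f ^+ 2 = 0.
  rewrite -[LHS]mul1r -g1'.
  rewrite (_ : _ * _ = c' ^+ 2 * (d ^+ 2 + f ^+ 2) - (c' * d + s' * f) * (c' * d - s' * f)).
    by rewrite df0 orth mulr0 mul0r subrr.
  by ring.
have f0 : f = 0 by apply/eqP; rewrite -sqrf_eq0 sqf0.
have d0 : d = 0 by apply/eqP; rewrite -sqrf_eq0 -[X in X == _]addr0 -{1}sqf0 df0.
by congr pair; apply/eqP; rewrite -subr_eq0 ?[_ - _]d0 ?[_ - _]f0.
Qed.

Lemma dist2C x y : dist2 x y = dist2 y x.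
Proof. by rewrite /dist2 -sqrrN opprB -[in X in _ + X]sqrrN opprB. Qed.

Lemma dist2_rot_refl e g x y x' y' : e ^+ 2 = 1 -> g \in circle ->
  x - y = rot_refl e g (x' - y') -> dist2 x y = dist2 x' y'.
Proof.
rewrite inE => e2 /eqP g1 [/= h1 h2]; rewrite /dist2 h1 h2.
transitivity ((g.1 ^+ 2 + g.2 ^+ 2) * ((x'.1 - y'.1) ^+ 2 + e ^+ 2 * (x'.2 - y'.2) ^+ 2)).
  by ring.
by rewrite g1 e2 !mul1r.
Qed.

(** The second moment counts triples [(g, p, p')] in which one motion sends both first points to the
    second ones. The diagonal [p = p'] gives the first term; any other pair admits at most one [g],
    and only if the two distances agree. *)
Lemma sum_overlap_sqr e E : e ^+ 2 = 1 ->
  (\sum_(g in circle) \sum_z overlap e E g z ^ 2 <= #|circle| * #|E| ^ 2 + dist_energy E)%N.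
Proof.
move=> e2; set EE := setX E E.
pose k g (p : (F * F) * (F * F)) := p.2 - rot_refl e g p.1.
rewrite (eq_bigr (fun g => \sum_(p in EE)
  #|[set p' in EE | k g p' == k g p]|)%N); last first.
  by move=> g _; exact: sum_card_fiber_sqr.
rewrite exchange_big /=.
pose same (p p' : (F * F) * (F * F)) := dist2 p'.2 p.2 == dist2 p'.1 p.1.
apply: leq_trans (_ : \sum_(p in EE) (#|circle| + #|[set p' in EE | same p p']|) <= _)%N.
  apply: leq_sum => p pE.
  rewrite (card_sig_sum circle EE (fun g p' => k g p' == k g p)).
  rewrite (bigD1 p) //= leq_add //.
    by apply/subset_leq_card/subsetP => g /[!inE]/andP[].
  apply: leq_trans (_ : \sum_(p' in EE | p' != p) same p p' <= _)%N; last first.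
    by rewrite card_set_sum [leqRHS](bigD1 p) //= leq_addl.
  apply: leq_sum => -[x' y'] /andP[_ ne]; case: p pE ne => x y _ ne; rewrite /same /=.
  have gE g : (k g (x', y') == k g (x, y)) = (y' - y == rot_refl e g (x' - x)).
    by rewrite -subr_eq0 -[RHS]subr_eq0 /k /= rot_reflB !opprD !opprK addrACA.
  have [g1|no_g] := pickP [pred g in circle | k g (x', y') == k g (x, y)]; last first.
    rewrite (eq_card0 (_ : _ =i pred0)) // => g; rewrite inE.
    exact: no_g.
  rewrite inE gE => /andP[g1C /eqP e1].
  rewrite (dist2_rot_refl e2 g1C e1) eqxx; apply: leq_trans (_ : #|[set g1]| <= _)%N;
    last by rewrite cards1.
  apply/subset_leq_card/subsetP => g.
  rewrite !inE gE => /andP[gC /eqP e3]; apply/eqP; apply: (@rot_refl_inj e (x' - x)) => //.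
  (* If the first points coincide, so do their images, contradicting that the pairs differ. *)
  - apply: contraNneq ne => xx0; move: e1; rewrite xx0 => e1.
    move/eqP: xx0; rewrite subr_eq0 => /eqP->; apply/eqP; congr pair.
    apply/eqP; rewrite -subr_eq0 e1; apply/eqP; rewrite /rot_refl /=.
    by congr pair; rewrite !mulr0 ?subr0 ?addr0.
  - by rewrite inE.
  - by rewrite -e1 -e3.
rewrite big_split sum_nat_const cardsX mulnn [X in (X + _)%N]mulnC leq_add2l /=.
rewrite /dist_energy sum_card_fiber_sqr -/EE -!card_setX_sum.
(* Regroups two point-image pairs as a pair of points and a pair of images. *)
pose f (r : ((F * F) * (F * F)) * ((F * F) * (F * F))) :=
  ((r.1.1, r.2.1), (r.1.2, r.2.2)).
have fK : cancel f f by move=> [[? ?] []].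
rewrite leq_eqVlt -(on_card_preimset (f := f)); last by exists f => ? _.
apply/orP; left; apply/eqP; apply: eq_card => -[[x y] [x' y']].
rewrite !inE /same /=.
by rewrite (dist2C x) (dist2C x'); do 4 case: (_ \in E).
Qed.

End Plane.

(** * Second and third moments of the overlaps *)

Section Overlaps.
Variable F : finFieldType.
Hypothesis F_odd : odd #|F|.

(** The term [N ^+ 4 / q] of the energy cancels against [n] times [N ^+ 4 / q ^+ 2], up to twice the
    latter, because [n] is at least [q - 2]. This remainder, the diagonal pairs and the energy error
    each cost [2 * q * m * N ^+ 2], giving the [6]. *)
Lemma overlap_variance (R : realFieldType) (e : F) (A B : {set F}) :
  e ^+ 2 = 1 -> (0 < #|A|)%N -> (0 < #|B|)%N ->
  \sum_(g in circle F) \sum_z ((overlap e (setX A B) g z)%:R -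
      (#|A| * #|B|)%:R ^+ 2 / #|F|%:R ^+ 2) ^+ 2
    <= 6 * #|F|%:R * (minn #|A| #|B|)%:R * (#|A| * #|B|)%:R ^+ 2 :> R.
Proof.
move=> e2 A_gt0 B_gt0; set N : R := (_ * _)%:R; set q : R := #|F|%:R; set m : R := (minn _ _)%:R.
set E := setX A B; pose mu := N ^+ 2 / q ^+ 2; pose n : R := #|circle F|%:R.
have q_ge1 : 1 <= q by rewrite ler1n (leq_trans A_gt0) ?max_card.
have q_neq0 : q != 0 by rewrite gt_eqF // (lt_le_trans ltr01).
have m_ge1 : 1 <= m by rewrite ler1n leq_min A_gt0.
have n_le : n <= 2 * q by rewrite -natrM ler_nat card_circle_le.
have n_ge : q <= n + 2 by rewrite -natrD ler_nat card_circle_ge.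
have N2_le : N ^+ 2 <= q ^+ 3 * m.
  rewrite -!natrX -natrM ler_nat expnMn.
  have key x y : (x <= #|F| -> y <= #|F| -> x ^ 2 * y ^ 2 <= #|F| ^ 3 * x)%N.
    move=> xF yF; rewrite (_ : _ * y ^ 2 = x * (y * y) * x)%N; last by ring.
    by rewrite leq_mul2r !expnS expn0 muln1 !leq_mul ?orbT.
  case: (leqP #|A| #|B|) => _; first by rewrite key ?max_card.
  by rewrite mulnC key ?max_card.
have energy_le : (dist_energy E)%:R <= N ^+ 4 / q + 2 * q * m * N ^+ 2.
  rewrite /m; case: (leqP #|A| #|B|) => _; first exact: dist_energy_product.
  by rewrite /E dist_energy_swap /N mulnC dist_energy_product.
have S2 : \sum_(g in circle F) \sum_z (overlap e E g z)%:R ^+ 2 <=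
    n * N ^+ 2 + (N ^+ 4 / q + 2 * q * m * N ^+ 2).
  apply: le_trans (_ : (#|circle F| * #|E| ^ 2 + dist_energy E)%:R <= _).
    apply: le_trans (_ : (\sum_(g in circle F) \sum_z overlap e E g z ^ 2)%:R <= _); last first.
      by rewrite ler_nat sum_overlap_sqr.
    rewrite natr_sum le_eqVlt; apply/orP; left; apply/eqP; apply: eq_bigr => g _.
    by rewrite natr_sum; apply: eq_bigr => z _; rewrite natrX.
  by rewrite natrD natrM natrX cardsX lerD2l.
have -> : \sum_(g in circle F) \sum_z ((overlap e E g z)%:R - mu) ^+ 2 =
    \sum_(g in circle F) \sum_z (overlap e E g z)%:R ^+ 2 - n * (N ^+ 4 / q ^+ 2).
  rewrite (eq_bigr (fun g => \sum_z (overlap e E g z)%:R ^+ 2 - N ^+ 4 / q ^+ 2)).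
    by rewrite sumrB sumr_const -[_ *+ #|_|]mulr_natl.
  move=> g _; rewrite sum_sqrB -natr_sum sum_overlap cardsX card_prod natrX natrM.
  by rewrite -/q -/N /mu; field.
have q2_gt0 : 0 < q ^+ 2 by rewrite exprn_gt0 // (lt_le_trans ltr01).
have N2_ge0 : 0 <= N ^+ 2 by exact: sqr_ge0.
have main_term : N ^+ 4 / q <= (n + 2) * (N ^+ 4 / q ^+ 2).
  rewrite [leLHS](_ : _ = q * (N ^+ 4 / q ^+ 2)); last by field.
  by rewrite ler_wpM2r // divr_ge0 ?exprn_even_ge0.
have err_term : N ^+ 4 / q ^+ 2 <= q * m * N ^+ 2.
  rewrite ler_pdivrMr // (_ : N ^+ 4 = N ^+ 2 * N ^+ 2); last by ring.
  rewrite [leRHS](_ : _ = q ^+ 3 * m * N ^+ 2); last by ring.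
  by rewrite ler_wpM2r.
have n_term : n * N ^+ 2 <= 2 * q * m * N ^+ 2.
  rewrite ler_wpM2r // (le_trans n_le) // ler_peMr //; lra.
lra.
Qed.

Lemma sum_overlap_cube (R : realFieldType) (e : F) (A B : {set F}) : e ^+ 2 = 1 ->
  (#|F| ^ 4 <= #|A| ^ 2 * #|B| ^ 3)%N -> (#|F| ^ 3 <= (#|A| * #|B|) ^ 2)%N ->
  (\sum_(g in circle F) \sum_z overlap e (setX A B) g z ^ 3)%:R <=
    18 * (#|A| * #|B|)%:R ^+ 6 / #|F|%:R ^+ 3 :> R.
Proof.
move=> e2 q4_le q3_le; set N : R := (_ * _)%:R; set q : R := #|F|%:R.
have F_gt0 : (0 < #|F|)%N by apply/card_gt0P; exists 0.
have AB_gt0 : (0 < #|A| * #|B|)%N.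
  by rewrite -(ltn_sqr 0) (leq_trans _ q3_le) // expn_gt0 F_gt0.
move: (AB_gt0); rewrite muln_gt0 => /andP[A_gt0 B_gt0].
have q_gt0 : 0 < q by rewrite ltr0n.
have N_gt0 : 0 < N by rewrite ltr0n.
have e0 : e != 0 by apply: contra_eq_neq e2 => ->; rewrite expr0n eq_sym oner_neq0.
have := overlap_variance R e2 A_gt0 B_gt0; rewrite -/N -/q /=.
set E := setX A B; set mu := N ^+ 2 / q ^+ 2; set m : R := (minn _ _)%:R => var_le.
pose r g z : R := (overlap e E g z)%:R.
have mu2_ge0 : 0 <= 2 * mu ^+ 2 by apply: mulr_ge0 => //; exact: sqr_ge0.
have m2_ge0 : 0 <= 2 * m ^+ 2 by apply: mulr_ge0 => //; exact: sqr_ge0.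
(* Off the axis, [r ^+ 2 <= 2 * (r - mu) ^+ 2 + 2 * mu ^+ 2] is multiplied by [r], which is bounded
   by [m ^+ 2] in the first term only. On the axis, [r <= N] gives [N ^+ 4]. *)
have cube_le g : \sum_z r g z ^+ 3 <=
    2 * m ^+ 2 * \sum_z (r g z - mu) ^+ 2 + 2 * mu ^+ 2 * N ^+ 2 + N ^+ 4 * (g.2 == 0)%:R.
  have sum_r : \sum_z r g z = N ^+ 2 by rewrite -natr_sum sum_overlap natrX cardsX.
  have [s0|s0] := eqVneq g.2 0.
    rewrite mulr1 -[leLHS]add0r lerD //.
      apply: addr_ge0 (mulr_ge0 mu2_ge0 (sqr_ge0 _)).
      by apply: mulr_ge0 m2_ge0 _; apply: sumr_ge0 => z _; exact: sqr_ge0.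
    rewrite (_ : N ^+ 4 = N ^+ 2 * N ^+ 2); last by ring.
    rewrite -{2}sum_r mulr_sumr ler_sum // => z _.
    rewrite exprSr ler_wpM2r ?ler0n // ler_pXn2r ?nnegrE ?ler0n //.
    by rewrite ler_nat -cardsX overlap_le.
  rewrite mulr0 addr0 -sum_r !mulr_sumr -big_split ler_sum //= => z _.
  have r0 : 0 <= r g z by rewrite ler0n.
  have rm : r g z <= m ^+ 2 by rewrite -natrX ler_nat overlap_product_le.
  have : r g z ^+ 2 <= 2 * (r g z - mu) ^+ 2 + 2 * mu ^+ 2.
    by have := sqr_ge0 (r g z - 2 * mu); nra.
  have := sqr_ge0 (r g z - mu); move: (r g z - mu) => d; nra.
have axis_card : (\sum_(g in circle F) (g.2 == 0%R) <= 2)%N.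
  rewrite -card_set_sum -(card_in_imset (f := fst)).
    apply: leq_trans (card_sqr_eq (1 : F)).
    apply/subset_leq_card/subsetP => _ /imsetP[g + ->].
    by rewrite !inE => /andP[/eqP <- /eqP->]; rewrite expr0n addr0.
  by move=> [c s] [c' s'] /[!inE] /= /andP[_ /eqP->] /andP[_ /eqP->] ->.
have sum_le : (\sum_(g in circle F) \sum_z overlap e E g z ^ 3)%:R <=
    2 * m ^+ 2 * (6 * q * m * N ^+ 2) + (2 * q) * (2 * mu ^+ 2 * N ^+ 2) + N ^+ 4 * 2.
  rewrite natr_sum; apply: le_trans (_ : \sum_(g in circle F) (2 * m ^+ 2 *
     \sum_z (r g z - mu) ^+ 2 + 2 * mu ^+ 2 * N ^+ 2 + N ^+ 4 * (g.2 == 0)%:R) <= _).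
    apply: ler_sum => g _; rewrite natr_sum; apply: le_trans (cube_le g).
    by rewrite le_eqVlt; apply/orP; left; apply/eqP/eq_bigr => z _; rewrite natrX.
  rewrite !big_split /= sumr_const -!mulr_sumr !lerD //.
  - exact: ler_wpM2l m2_ge0 _ _ var_le.
  - rewrite -[_ *+ #|_|]mulr_natl ler_wpM2r ?(mulr_ge0 mu2_ge0 (sqr_ge0 _)) //.
    by rewrite -natrM ler_nat card_circle_le.
  - by rewrite ler_wpM2l ?exprn_even_ge0 // -natr_sum ler_nat.
apply: le_trans sum_le _.
have q3_le' : q ^+ 3 <= N ^+ 2 by rewrite -!natrX ler_nat.
(* After the hypothesis on [#|A| ^ 2 * #|B| ^ 3], it remains to absorb [m ^+ 3], whichever factor is
   the smaller. *)
have q4m3_le : q ^+ 4 * m ^+ 3 <= N ^+ 4.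
  rewrite -!natrX -natrM ler_nat.
  apply: leq_trans (_ : #|A| ^ 2 * #|B| ^ 3 * minn #|A| #|B| ^ 3 <= _)%N.
    by rewrite leq_mul2r q4_le orbT.
  have [leAB|/ltnW leBA] := leqP #|A| #|B|.
    rewrite (_ : _ * _ = (#|A| * #|B|) ^ 3 * (#|A| * #|A|))%N; last by ring.
    by rewrite [leqRHS]expnSr leq_mul2l leq_mul2l leAB !orbT.
  rewrite (_ : _ * _ = (#|A| * #|B|) ^ 2 * (#|B| ^ 2 * #|B| ^ 2))%N; last by ring.
  rewrite (_ : _ ^ 4 = (#|A| * #|B|) ^ 2 * (#|A| ^ 2 * #|B| ^ 2))%N; last by ring.
  by rewrite leq_mul2l leq_mul2r leq_exp2r // leBA !orbT.
rewrite ler_pdivlMr ?exprn_gt0 //.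
(* The [18] splits as [12] from the variance, [4] from the mean and [2] from the two diagonal
   [g]. *)
have k1 : (2 * m ^+ 2 * (6 * q * m * N ^+ 2)) * q ^+ 3 <= 12 * N ^+ 6.
  rewrite (_ : _ * q ^+ 3 = 12 * N ^+ 2 * (q ^+ 4 * m ^+ 3)); last by ring.
  rewrite (_ : 12 * N ^+ 6 = 12 * N ^+ 2 * N ^+ 4); last by ring.
  by rewrite ler_wpM2l // mulr_ge0 ?sqr_ge0.
have k2 : (2 * q * (2 * mu ^+ 2 * N ^+ 2)) * q ^+ 3 = 4 * N ^+ 6.
  by rewrite /mu; field; rewrite gt_eqF.
have k3 : N ^+ 4 * 2 * q ^+ 3 <= 2 * N ^+ 6.
  rewrite (_ : 2 * N ^+ 6 = N ^+ 4 * 2 * N ^+ 2); last by ring.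
  by rewrite ler_wpM2l // mulr_ge0 // exprn_even_ge0.
lra.
Qed.

(** * From overlaps to congruence classes *)

Definition coords (x : point F) : F * F := (x 0 0, x 1 0).

Definition of_coords (v : F * F) : point F :=
  \col_(i < 2) if i == 0 then v.1 else v.2.

Lemma coordsK : cancel coords of_coords.
Proof.
move=> x; apply/matrixP => i j; rewrite mxE (ord1 j) /=.
by case: (splitP (i : 'I_(1 + 1))) => k ik; rewrite (ord1 k) in ik;
  case: ifP => [/eqP->//|/negbT/eqP i0]; congr (x _ _); apply/val_inj; rewrite //= ik;
  case: i0; apply/val_inj.
Qed.

Lemma of_coordsK : cancel of_coords coords.
Proof. by case=> a b; rewrite /coords !mxE. Qed.

Lemma coordsD x y : coords (x + y) = coords x + coords y.
Proof. by rewrite /coords !mxE. Qed.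

Lemma cartesianE (A B : {set F}) x : (x \in cartesian A B) = (coords x \in setX A B).
Proof. by rewrite !inE. Qed.

Lemma card_cartesian (A B : {set F}) : #|cartesian A B| = (#|A| * #|B|)%N.
Proof.
rewrite -cardsX -(on_card_preimset (f := coords)).
  by apply: eq_card => x; rewrite cartesianE [RHS]inE.
by exists of_coords => x _; [exact: coordsK | exact: of_coordsK].
Qed.

Lemma std_formE (x : point F) : std_form x = (coords x).1 ^+ 2 + (coords x).2 ^+ 2.
Proof.
by rewrite /std_form big_ord_recl big_ord1; congr (_ + x _ _ ^+ 2); apply/val_inj.
Qed.

(* [e] is the determinant of [theta] and [g] its first column. *)
Lemma orthogonal_rot_refl (theta : 'M[F]_2) : theta \in orthogonal_group F ->
  exists (e : F) (g : F * F), [/\ e ^+ 2 = 1, g \in circle F &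
    forall x, coords (theta *m x) = rot_refl e g (coords x)].
Proof.
rewrite inE => /andP[_ /forallP isom].
pose p := theta 0 0; pose r := theta 0 1; pose s := theta 1 0; pose t := theta 1 1.
have mulE x : coords (theta *m x) =
    (p * (coords x).1 + r * (coords x).2, s * (coords x).1 + t * (coords x).2).
  rewrite /coords !mxE !big_ord_recl !big_ord0 !addr0.
  by congr (_ * _ + _ * _, _ * _ + _ * _); congr (_ _ _); apply/val_inj.
have formE a b : (p * a + r * b) ^+ 2 + (s * a + t * b) ^+ 2 = a ^+ 2 + b ^+ 2.
  by have /eqP := isom (of_coords (a, b)); rewrite !std_formE mulE of_coordsK.
have ps : p ^+ 2 + s ^+ 2 = 1 by have := formE 1 0; rewrite !(mulr1, mulr0, addr0, expr1n, expr0n).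
have rt : r ^+ 2 + t ^+ 2 = 1 by have := formE 0 1; rewrite !(mulr1, mulr0, add0r, expr1n, expr0n).
(* Polarization: the form is evaluated at [(1, 1)]. *)
have orth : p * r + s * t = 0.
  apply: (mulfI (odd_card_two_neq0 F_odd)); rewrite mulr0.
  transitivity ((p * 1 + r * 1) ^+ 2 + (s * 1 + t * 1) ^+ 2 -
    (p ^+ 2 + s ^+ 2) - (r ^+ 2 + t ^+ 2)).
    by ring.
  by rewrite formE ps rt; ring.
exists (p * t - r * s), (p, s); split.
(* Lagrange's identity for the square of the determinant. *)
- transitivity ((p ^+ 2 + s ^+ 2) * (r ^+ 2 + t ^+ 2) - (p * r + s * t) ^+ 2); first by ring.
  by rewrite ps rt orth; ring.
- by rewrite inE /= ps.
- move=> x; rewrite mulE /rot_refl /=.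
  have rE : r = - ((p * t - r * s) * s).
    rewrite (_ : - _ = r * (p ^+ 2 + s ^+ 2) - p * (p * r + s * t)); last by ring.
    by rewrite ps orth; ring.
  have tE : t = (p * t - r * s) * p.
    rewrite (_ : _ * p = t * (p ^+ 2 + s ^+ 2) - s * (p * r + s * t)); last by ring.
    by rewrite ps orth; ring.
  by rewrite -tE -mulNr -rE.
Qed.

(** [k] packs the determinant, the first column and the translation, so that rigid motions can be
    summed over. *)
Definition motion (k : F * ((F * F) * (F * F))) (x : point F) : point F :=
  of_coords (k.2.2 + rot_refl k.1 k.2.1 (coords x)).

Definition motions : {set F * ((F * F) * (F * F))} :=
  setX [set e | e ^+ 2 == 1] (setX (circle F) setT).

Lemma congruent_motion (x y : triangle F) : congruent x y ->
  exists2 k, k \in motions & y = [ffun i => motion k (x i)].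
Proof.
case/exists_inP => theta /orthogonal_rot_refl[e [g [e2 gC rotE]]] /existsP[z /forallP yE].
exists (e, (g, coords z)); first by rewrite !in_setX inE /= e2 eqxx gC inE.
by apply/ffunP => i; rewrite ffunE -(eqP (yE i)) /motion /= -rotE -coordsD coordsK.
Qed.

Definition triangles_in (E : {set point F}) : {set triangle F} :=
  [set x : triangle F | [forall i, x i \in E]].

Lemma card_triangles_in E : #|triangles_in E| = (#|E| ^ 3)%N.
Proof.
have := card_ffun_on 'I_3 (mem E); rewrite card_ord => <-; apply: eq_card => x.
by rewrite inE; apply/forallP/ffun_onP.
Qed.

(** Each congruent pair is charged to a motion carrying [x] to [y]. After exchanging the sums, the
    triangles kept inside the set by a fixed motion are the triples of points that it keeps inside,
    hence the cube. *)
Lemma sum_congruent_le (A B : {set F}) :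
  (\sum_(x in triangles_in (cartesian A B))
      #|[set y in triangles_in (cartesian A B) | congruent x y]| <=
   \sum_(e in [set e : F | (e ^+ 2 == 1)%R]) \sum_(g in circle F)
      \sum_z overlap e (setX A B) g z ^ 3)%N.
Proof.
set S := triangles_in _.
apply: leq_trans (_ : \sum_(x in S)
    #|[set k in motions | [ffun i => motion k (x i)] \in S]| <= _)%N.
  apply: leq_sum => x _.
  apply: leq_trans (leq_imset_card (fun k => [ffun i => motion k (x i)]) _).
  apply/subset_leq_card/subsetP => y; rewrite inE => /andP[yS /congruent_motion[k kK yE]].
  by apply/imsetP; exists k; rewrite // inE kK -yE.
rewrite card_sig_sum.
under [leqRHS]eq_bigr do rewrite pair_big_dep /=.
rewrite pair_big_dep /= [leqLHS](eq_bigl (fun k => (k.1 \in [set e | e ^+ 2 == 1]) &&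
   ((k.2.1 \in circle F) && true))); last by move=> k; rewrite !inE.
apply: leq_sum => -[e [g z]] _ /=.
apply: leq_trans (_ : #|triangles_in [set v in cartesian A B |
    motion (e, (g, z)) v \in cartesian A B]| <= _)%N.
  apply/subset_leq_card/subsetP => x; rewrite !inE => /andP[/forallP xE /forallP mE].
  by apply/forallP => i; rewrite inE xE; have := mE i; rewrite ffunE.
rewrite card_triangles_in leq_exp2r //.
pose f v := (coords v, z + rot_refl e g (coords v)).
rewrite /overlap -(card_in_imset (f := f)); last first.
  by move=> v v' _ _ /(congr1 fst); exact: (can_inj coordsK).
apply/subset_leq_card/subsetP => _ /imsetP[v + ->].
rewrite inE !cartesianE /motion of_coordsK /= => /andP[vE mE].
by rewrite inE /= in_setX vE mE addrK eqxx.
Qed.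

(** Cauchy-Schwarz over the determined classes, the only ones that triangles of [E] meet; the
    squared class sizes count congruent pairs. *)
Lemma card_triangles_sqr_le (R : realFieldType) E :
  #|triangles_in E|%:R ^+ 2 <= #|determined_classes E|%:R *
    (\sum_(x in triangles_in E) #|[set y in triangles_in E | congruent x y]|)%:R :> R.
Proof.
set S := triangles_in E; set D := determined_classes E.
pose cls (x : triangle F) := pblock (congruence_classes F) x.
have eqv := congruent_equivalence (F := F).
have part := equivalence_partitionP eqv.
have clsD x : x \in S -> cls x \in D.
  move=> xS; rewrite inE pblock_mem ?(cover_partition part) ?inE //=.
  apply/exists_inP; exists x; last by rewrite inE in xS.
  by rewrite mem_pblock (cover_partition part) inE.
have -> : #|S|%:R = \sum_(C in D) #|[set x in S | cls x == C]|%:R :> R.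
  rewrite -natr_sum -(sum_card_fiber S cls) [X in X%:R](bigID (mem D)) /=.
  rewrite [X in (_ + X)%N]big1 ?addn0 // => C CD; apply: eq_card0 => x.
  by rewrite !inE; apply/negP => /andP[xS /eqP xC]; rewrite -xC clsD // inE in CD.
apply: le_trans (sqr_sum_le _ _) _; rewrite ler_wpM2l ?ler0n //.
apply: le_trans (_ : (\sum_C #|[set x in S | cls x == C]| ^ 2)%:R <= _).
  rewrite natr_sum [leRHS](bigID (mem D)) /= -[leLHS]addr0 lerD ?sumr_ge0 //.
  by apply: ler_sum => C _; rewrite natrX.
rewrite sum_card_fiber_sqr ler_nat; apply: leq_sum => x xS.
apply/subset_leq_card/subsetP => y; rewrite !inE => /andP[-> /eqP yx] /=.
rewrite -(pblock_equivalence_partition eqv) ?inE //.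
by rewrite -[pblock _ x]yx mem_pblock (cover_partition part) inE.
Qed.

(** Each of the at most two signs [e] contributes [18 * N ^+ 6 / q ^+ 3] congruent pairs, which
    gives the [36]; the [N ^+ 6] then cancels. *)
Lemma determined_classes_ge (R : realFieldType) (A B : {set F}) :
  (#|F| ^ 4 <= #|A| ^ 2 * #|B| ^ 3)%N -> (#|F| ^ 3 <= (#|A| * #|B|) ^ 2)%N ->
  36^-1 * #|F|%:R ^+ 3 <= #|determined_classes (cartesian A B)|%:R :> R.
Proof.
move=> q4_le q3_le; set D : R := _%:R; set q : R := #|F|%:R.
pose N : R := (#|A| * #|B|)%:R.
have F_gt0 : (0 < #|F|)%N by apply/card_gt0P; exists 0.
have q_gt0 : 0 < q by rewrite ltr0n.
have N_gt0 : 0 < N by rewrite ltr0n -(ltn_sqr 0) (leq_trans _ q3_le) // expn_gt0 F_gt0.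
have := card_triangles_sqr_le R (cartesian A B).
rewrite card_triangles_in card_cartesian natrX -exprM -/N -/D => N6_le.
have : (\sum_(x in triangles_in (cartesian A B))
    #|[set y in triangles_in (cartesian A B) | congruent x y]|)%:R <=
    36 * N ^+ 6 / q ^+ 3 :> R.
  have := sum_congruent_le A B; rewrite -(ler_nat R) => /le_trans; apply.
  rewrite natr_sum; apply: le_trans (_ : \sum_(e in [set e : F | e ^+ 2 == 1])
    18 * N ^+ 6 / q ^+ 3 <= _).
    by apply: ler_sum => e; rewrite inE => /eqP e2; exact: sum_overlap_cube.
  rewrite sumr_const -[_ *+ #|_|]mulr_natl.
  apply: le_trans (_ : 2 * (18 * N ^+ 6 / q ^+ 3) <= _); last by rewrite !mulrA -natrM.
  rewrite ler_wpM2r ?ler_nat ?card_sqr_eq // divr_ge0 ?mulr_ge0 ?exprn_ge0 //; exact: ltW.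
move=> /(ler_wpM2l (ler0n R _ : 0 <= D)) /(le_trans N6_le).
rewrite [leRHS](_ : _ = (D * 36 / q ^+ 3) * N ^+ 6); last by ring.
rewrite -{1}[N ^+ _]mul1r ler_pM2r ?exprn_gt0 // ler_pdivlMr ?exprn_gt0 // mul1r => q3D.
by rewrite mulrC ler_pdivrMr.
Qed.

End Overlaps.

(** * From real exponents to integer inequalities *)

Theorem theorem1p6 (R : realType) :
  exists2 c : R, 0 < c &
    forall (F : finFieldType) (q : nat), #|F| = q -> odd q ->
    forall (A B : {set F}) (epsilon : R), 0 <= epsilon ->
      q%:R `^ (1 / 2 + epsilon) <= #|A|%:R ->
      q%:R `^ (1 - 2 * epsilon / 3) <= #|B|%:R ->
      c * q%:R ^+ 3 <= #|determined_classes (cartesian A B)|%:R.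
Proof.
exists 36^-1; first by rewrite invr_gt0.
move=> F q <- F_odd A B epsilon eps_ge0 A_ge B_ge.
have F_gt0 : (0 < #|F|)%N by apply/card_gt0P; exists 0.
have q_ge1 : 1 <= #|F|%:R :> R by rewrite ler1n.
have q_neq0 : #|F|%:R != 0 :> R by rewrite pnatr_eq0 -lt0n.
have powX x n : (#|F|%:R `^ x) ^+ n = #|F|%:R `^ (x * n%:R) :> R.
  by rewrite powRrM powR_mulrn ?powR_ge0.
have powD x y : #|F|%:R `^ x * #|F|%:R `^ y = #|F|%:R `^ (x + y) :> R.
  by rewrite powRD // q_neq0 implybT.
have AX n : #|F|%:R `^ ((1 / 2 + epsilon) * n%:R) <= (#|A| ^ n)%:R.
  by rewrite -powX natrX lerXn2r ?nnegrE ?powR_ge0 ?ler0n.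
have BX n : #|F|%:R `^ ((1 - 2 * epsilon / 3) * n%:R) <= (#|B| ^ n)%:R.
  by rewrite -powX natrX lerXn2r ?nnegrE ?powR_ge0 ?ler0n.
have prodX m n k : k%:R <= (1 / 2 + epsilon) * m%:R + (1 - 2 * epsilon / 3) * n%:R ->
    (#|F| ^ k <= #|A| ^ m * #|B| ^ n)%N.
  move=> k_le; rewrite -(ler_nat R) natrX natrM -powR_mulrn ?ler0n //.
  apply: le_trans (ler_pM (powR_ge0 _ _) (powR_ge0 _ _) (AX m) (BX n)).
  by rewrite powD ler_powR.
(* The weights [2] and [3] cancel [epsilon] and give exponent exactly [4]; the weights [2] and [2]
   give [3 + 2 * epsilon / 3], at least [3] since [epsilon] is nonnegative. *)
apply: determined_classes_ge => //; first by apply: prodX; lra.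
by rewrite expnMn; apply: prodX; lra.
Qed.
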